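(* $$\frac{16\sqrt{3}}{3} = \sum_{k=0}^{\infty}\left(\frac14\right)^{k}\frac{\left(\frac12\right)_k\left(\frac56\right)_k\left(\frac76\right)_k}{(1)_k\left(\frac43\right)_k\left(\frac43\right)_k}\,(18k+7).$$
   Context: For $k\in\mathbb{N}_0$, $(\alpha)_k=\alpha(\alpha+1)\cdots(\alpha+k-1)$ is the rising factorial (Pochhammer symbol), with $(\alpha)_0=1$. *)

(* Defs.v *)
From Stdlib Require Import Reals.
From Coquelicot Require Import Coquelicot.
Open Scope R_scope.

(* Rising factorial (a)_k = a (a+1) ... (a+k-1). *)
Fixpoint pochhammer (a : R) (k : nat) : R :=
  match k with
  | O => 1
  | S j => pochhammer a j * (a + INR j)
  end.

(* Main.v *)
Require Import Defs.
From Stdlib Require Import Reals Lra Lia.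
From Coquelicot Require Import Coquelicot.
Open Scope R_scope.

(** The series is the Gessel-Stanton strange evaluation
      5F4(2a, 2b, 1-2b, 1+2a/3, -n; a-b+1, a+b+1/2, 2a/3, 1+2a+2n; 1/4)
    at (a, b, n) = (7/12, 1/4, -5/6), where the series does not terminate. A WZ certificate relates the sums at [a] and
    [a + 1], and the sum tends to 1 as [a] tends to infinity, so the value is an infinite product of Pochhammer ratios.
    Duplication reduces this product to three values cos (PI s / 2) = prod (1 - s^2 / (2 j + 1)^2), at
    s = 1/2, 1/3, 2/3, and to one limit of the form (1/6 + m)_m / (2/3 + m)_m -> 1 / sqrt 2. The cosine product
    comes from the two-step recursion in [n] of the moments of cos (s t) cos^n t over [0, PI/2]. *)

(** * Rising factorials *)

Lemma pochhammer_S (a : R) (k : nat) :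
  pochhammer a (S k) = pochhammer a k * (a + INR k).
Proof. reflexivity. Qed.

Lemma pochhammer_pos (a : R) (k : nat) : 0 < a -> 0 < pochhammer a k.
Proof.
  intros Ha; induction k as [|k IH]; simpl; [lra|].
  apply Rmult_lt_0_compat; [exact IH|]. pose proof (pos_INR k); lra.
Qed.

Lemma pochhammer_le (a b : R) (k : nat) :
  0 < a <= b -> pochhammer a k <= pochhammer b k.
Proof.
  intros Hab; induction k as [|k IH]; simpl; [lra|].
  pose proof (pos_INR k). pose proof (pochhammer_pos a k ltac:(lra)).
  apply Rmult_le_compat; lra.
Qed.

Lemma pochhammer_shift (a : R) (k : nat) :
  a * pochhammer (a + 1) k = pochhammer a k * (a + INR k).
Proof.
  induction k as [|k IH]; [simpl; ring|].
  rewrite !pochhammer_S, <- Rmult_assoc, IH, S_INR; ring.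
Qed.

Lemma pochhammer_split (a : R) (m n : nat) :
  pochhammer a (m + n) = pochhammer a m * pochhammer (a + INR m) n.
Proof.
  induction n as [|n IH].
  - rewrite Nat.add_0_r; simpl; ring.
  - rewrite Nat.add_succ_r; simpl. rewrite IH, plus_INR; ring.
Qed.

(** Legendre duplication: the factors of even and of odd index are collected separately, and a 2 is
    taken out of each. *)
Lemma pochhammer_double (a : R) (n : nat) :
  pochhammer a (n + n) = 4 ^ n * (pochhammer (a / 2) n * pochhammer ((a + 1) / 2) n).
Proof.
  induction n as [|n IH]; [simpl; ring|].
  rewrite Nat.add_succ_r, Nat.add_succ_l; rewrite !pochhammer_S, IH.
  rewrite S_INR, plus_INR; simpl; field.
Qed.

(** * The product for the cosine *)

Definition cos_moment (s : R) (n : nat) : R :=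
  RInt (fun t => cos (s * t) * cos t ^ n) 0 (PI / 2).

Lemma cos_moment_continuous (s : R) (n : nat) (t : R) :
  continuous (fun t => cos (s * t) * cos t ^ n) t.
Proof. apply (ex_derive_continuous (K := R_AbsRing) (V := R_NormedModule)). auto_derive. auto. Qed.

Lemma ex_cos_moment (s : R) (n : nat) :
  ex_RInt (fun t => cos (s * t) * cos t ^ n) 0 (PI / 2).
Proof. apply (ex_RInt_continuous (V := R_CompleteNormedModule)); intros t _; apply cos_moment_continuous. Qed.

(** Two integrations by parts, packed into one explicit antiderivative [F]. It vanishes at [PI / 2]
    through the positive powers of the cosine and at 0 through the sines, so no boundary term is
    left. *)
Lemma cos_moment_rec (s : R) (n : nat) :
  ((INR n + 2) ^ 2 - s ^ 2) * cos_moment s (n + 2)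
  = (INR n + 1) * (INR n + 2) * cos_moment s n.
Proof.
  set (F := fun t => (INR n + 2) * (cos t ^ (n + 1) * sin t * cos (s * t))
                     - s * (cos t ^ (n + 2) * sin (s * t))).
  set (f := fun t => ((INR n + 2) ^ 2 - s ^ 2) * (cos (s * t) * cos t ^ (n + 2))
                     - (INR n + 1) * (INR n + 2) * (cos (s * t) * cos t ^ n)).
  assert (Hd : forall t, is_derive F t (f t)).
  { intros t; unfold F, f.
    replace (n + 1)%nat with (S n) by lia; replace (n + 2)%nat with (S (S n)) by lia.
    auto_derive; [auto|].
    change (Init.Nat.pred (S n)) with n; change (Init.Nat.pred (S (S n))) with (S n).
    rewrite ?S_INR; simpl pow.
    (* The [match] is what [INR (S n)] computes to. *)
    replace (match n with O => 1 | S _ => INR n + 1 end) with (INR n + 1)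
      by (destruct n; simpl; ring).
    pose proof (sin2_cos2 t) as H; unfold Rsqr in H.
    apply Rminus_diag_uniq.
    transitivity ((INR n + 2) * (INR n + 1) * cos t ^ n * cos (s * t)
                  * (1 - (sin t * sin t + cos t * cos t))); [ring|].
    rewrite H; ring. }
  assert (Hi : is_RInt f 0 (PI / 2) (F (PI / 2) - F 0)).
  { apply (is_RInt_derive (V := R_CompleteNormedModule) F f); [intros; apply Hd|].
    intros t _; apply (ex_derive_continuous (K := R_AbsRing) (V := R_NormedModule)); unfold f; auto_derive; auto. }
  assert (Hj : is_RInt f 0 (PI / 2)
     (((INR n + 2) ^ 2 - s ^ 2) * cos_moment s (n + 2)
      - (INR n + 1) * (INR n + 2) * cos_moment s n)).
  { unfold f. apply (is_RInt_minus (V := R_NormedModule));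
      apply (is_RInt_scal (V := R_NormedModule));
      apply (RInt_correct (V := R_CompleteNormedModule)), ex_cos_moment. }
  apply Rminus_diag_uniq.
  rewrite <- (is_RInt_unique _ _ _ _ Hj), (is_RInt_unique _ _ _ _ Hi).
  unfold F. rewrite cos_PI2, Rmult_0_r, sin_0, !pow_i by lia. ring.
Qed.

(** Start of the two-step recursion along odd [n]; here the boundary term at [PI / 2] survives and
    brings in the cosine to be expanded. *)
Lemma cos_moment_1 (s : R) : (1 - s ^ 2) * cos_moment s 1 = cos (s * (PI / 2)).
Proof.
  set (F := fun t => sin t * cos (s * t) - s * (cos t * sin (s * t))).
  assert (Hi : is_RInt (fun t => (1 - s ^ 2) * (cos (s * t) * cos t ^ 1)) 0 (PI / 2)
                 (F (PI / 2) - F 0)).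
  { apply (is_RInt_derive (V := R_CompleteNormedModule) F).
    - intros t _; unfold F; auto_derive; [auto|]. ring.
    - intros t _; apply (ex_derive_continuous (K := R_AbsRing) (V := R_NormedModule)); auto_derive; auto. }
  assert (Hj : is_RInt (fun t => (1 - s ^ 2) * (cos (s * t) * cos t ^ 1)) 0 (PI / 2)
                 ((1 - s ^ 2) * cos_moment s 1)).
  { apply (is_RInt_scal (V := R_NormedModule)).
    apply (RInt_correct (V := R_CompleteNormedModule)), ex_cos_moment. }
  rewrite <- (is_RInt_unique _ _ _ _ Hj), (is_RInt_unique _ _ _ _ Hi).
  unfold F. rewrite cos_PI2, sin_PI2, Rmult_0_r, sin_0. ring.
Qed.

(** The cosine decreases on [0, PI/2], so [cos t <= cos (s * t) <= 1] there. *)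
Lemma cos_moment_squeeze (s : R) (n : nat) :
  0 <= s <= 1 -> cos_moment 0 (n + 1) <= cos_moment s n <= cos_moment 0 n.
Proof.
  intros Hs; pose proof PI_RGT_0.
  assert (Hc : forall t, 0 < t < PI / 2 -> 0 <= cos t ^ n).
  { intros t Ht; apply pow_le, cos_ge_0; lra. }
  split; apply RInt_le; try apply ex_cos_moment; try lra; intros t Ht;
    specialize (Hc t Ht); rewrite Rmult_0_l, cos_0.
  - rewrite pow_add, Rmult_1_l, pow_1, Rmult_comm.
    apply Rmult_le_compat_r; [exact Hc|]. apply cos_decr_1; nra.
  - apply Rmult_le_compat_r; [exact Hc|]. apply COS_bound.
Qed.

Lemma cos_moment_pos (n : nat) : 0 < cos_moment 0 n.
Proof.
  pose proof PI_RGT_0.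
  apply RInt_gt_0; [lra| |intros; apply cos_moment_continuous].
  intros t Ht. rewrite Rmult_0_l, cos_0, Rmult_1_l. apply pow_lt, cos_gt_0; lra.
Qed.

Lemma cos_moment_ratio (s : R) (n : nat) : 0 <= s <= 1 ->
  1 - / (INR n + 2) <= cos_moment s n / cos_moment 0 n <= 1.
Proof.
  intros Hs.
  pose proof (cos_moment_squeeze s n Hs) as [H1 H2].
  destruct (cos_moment_squeeze 0 (n + 1) ltac:(lra)) as [H3 _].
  replace (n + 1 + 1)%nat with (n + 2)%nat in H3 by lia.
  pose proof (cos_moment_rec 0 n) as H4.
  pose proof (cos_moment_pos n) as Hp. pose proof (pos_INR n).
  (* At [s = 0] the recursion is that of Wallis, with factor (n + 1) / (n + 2). Chaining the
     squeezes through [n + 1] then bounds the moment at [s] from below. *)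
  assert (H5 : cos_moment 0 (n + 2) = (1 - / (INR n + 2)) * cos_moment 0 n).
  { apply (Rmult_eq_reg_l ((INR n + 2) ^ 2 - 0 ^ 2)); [rewrite H4; field; lra|nra]. }
  destruct (cos_moment_squeeze 0 n ltac:(lra)) as [H6 _].
  split.
  - apply (Rmult_le_reg_r (cos_moment 0 n)); [exact Hp|].
    unfold Rdiv; rewrite Rmult_assoc, Rinv_l by lra. lra.
  - apply (Rmult_le_reg_r (cos_moment 0 n)); [exact Hp|].
    unfold Rdiv; rewrite Rmult_assoc, Rinv_l by lra. lra.
Qed.

(** Partial product of 1 - s^2 / (2 j + 1)^2 over j < m, with each factor written as ((1 - s) / 2 +
    j) ((1 + s) / 2 + j) / (1/2 + j)^2. *)
Definition cos_product (s : R) (m : nat) : R :=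
  pochhammer ((1 - s) / 2) m * pochhammer ((1 + s) / 2) m / pochhammer (1 / 2) m ^ 2.

(** An invariant in [m]: dividing the recursions at [s] and at 0 shows that the moment ratio loses
    exactly the factor 1 - s^2 / (2 m + 3)^2 which the product gains. *)
Lemma cos_product_moment (s : R) (m : nat) : 0 <= s < 1 ->
  cos_product s (S m)
  * (cos_moment s (2 * m + 1) / cos_moment 0 (2 * m + 1)) = cos (s * (PI / 2)).
Proof.
  intros Hs; unfold cos_product.
  induction m as [|m IH].
  - rewrite <- cos_moment_1. simpl pochhammer.
    replace (cos_moment 0 (2 * 0 + 1)) with 1.
    2:{ pose proof (cos_moment_1 0) as H. rewrite Rmult_0_l, cos_0 in H.
        change (2 * 0 + 1)%nat with 1%nat. lra. }
    change (2 * 0 + 1)%nat with 1%nat. simpl; field.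
  - rewrite <- IH. clear IH.
    rewrite !(pochhammer_S _ (S m)).
    pose proof (pochhammer_pos (1 / 2) (S m) ltac:(lra)) as Hq.
    replace (2 * S m + 1)%nat with (2 * m + 1 + 2)%nat by lia.
    pose proof (cos_moment_rec s (2 * m + 1)) as H1.
    pose proof (cos_moment_rec 0 (2 * m + 1)) as H2.
    pose proof (cos_moment_pos (2 * m + 1)) as Hp.
    pose proof (cos_moment_pos (2 * m + 1 + 2)) as Hp2.
    pose proof (pos_INR m) as Hm.
    rewrite plus_INR, mult_INR in H1, H2. simpl INR in H1, H2.
    rewrite S_INR.
    set (x := INR m) in *.
    set (P := pochhammer ((1 - s) / 2) (S m)). set (Q := pochhammer ((1 + s) / 2) (S m)).
    set (C := pochhammer (1 / 2) (S m)) in *.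
    set (u := cos_moment s (2 * m + 1)) in *. set (v := cos_moment 0 (2 * m + 1)) in *.
    set (u' := cos_moment s (2 * m + 1 + 2)) in *.
    set (v' := cos_moment 0 (2 * m + 1 + 2)) in *.
    assert (Hn : ((1 + 1) * x + 1 + 2) ^ 2 - s ^ 2 <> 0) by nra.
    assert (Eu : u' = ((1 + 1) * x + 1 + 1) * ((1 + 1) * x + 1 + 2) * u
                      / (((1 + 1) * x + 1 + 2) ^ 2 - s ^ 2)).
    { rewrite <- H1; field; exact Hn. }
    assert (Ev : v' = ((1 + 1) * x + 1 + 1) * ((1 + 1) * x + 1 + 2) * v
                      / (((1 + 1) * x + 1 + 2) ^ 2 - 0 ^ 2)).
    { rewrite <- H2; field; nra. }
    rewrite Eu, Ev. field. repeat split; nra.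
Qed.

Lemma is_lim_seq_inv_shift (c : R) : is_lim_seq (fun n => / (INR n + c)) 0.
Proof.
  replace (Finite 0) with (Rbar_inv p_infty) by reflexivity.
  apply is_lim_seq_inv; [|discriminate].
  eapply is_lim_seq_plus; [apply is_lim_seq_INR|apply is_lim_seq_const|reflexivity].
Qed.

Lemma cos_product_lim (s : R) : 0 <= s < 1 ->
  is_lim_seq (cos_product s) (cos (s * (PI / 2))).
Proof.
  intros Hs. apply is_lim_seq_incr_1.
  set (q := fun m => cos_moment s (2 * m + 1) / cos_moment 0 (2 * m + 1)).
  assert (Hq : forall m, 1 - / (INR m + 2) <= q m <= 1).
  { intros m. destruct (cos_moment_ratio s (2 * m + 1) ltac:(lra)) as [H1 H2].
    split; [|exact H2]. eapply Rle_trans; [|exact H1].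
    apply Rplus_le_compat_l, Ropp_le_contravar, Rinv_le_contravar.
    - pose proof (pos_INR m); lra.
    - apply Rplus_le_compat_r, le_INR; lia. }
  assert (Lq : is_lim_seq q 1).
  { apply (is_lim_seq_le_le (fun m => 1 - / (INR m + 2)) _ (fun _ => 1)); [exact Hq| |apply is_lim_seq_const].
    replace (Finite 1) with (Finite (1 - 0)) by (f_equal; ring).
    apply is_lim_seq_minus'; [apply is_lim_seq_const|apply is_lim_seq_inv_shift]. }
  replace (cos (s * (PI / 2))) with (cos (s * (PI / 2)) / 1) by field.
  apply (is_lim_seq_ext (fun m => cos (s * (PI / 2)) / q m)).
  - intros m. rewrite <- (cos_product_moment s m Hs). fold (q m).
    assert (q m <> 0).
    { specialize (Hq m). pose proof (pos_INR m).
      assert (/ (INR m + 2) < 1) by (rewrite <- Rinv_1; apply Rinv_lt_contravar; lra). lra. }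
    field; assumption.
  - apply is_lim_seq_div'; [apply is_lim_seq_const|exact Lq|lra].
Qed.

(** * Ratios of rising factorials at distance 1/2 *)

Definition half_ratio (a : R) (n : nat) : R := pochhammer a n / pochhammer (a + 1 / 2) n.

Lemma half_ratio_pos (a : R) (n : nat) : 0 < a -> 0 < half_ratio a n.
Proof.
  intros Ha; unfold half_ratio; apply Rdiv_lt_0_compat; apply pochhammer_pos; lra.
Qed.

(** Each factor (a + j) / (a + 1/2 + j) increases with [a]. *)
Lemma half_ratio_le (a b : R) (n : nat) :
  0 < a <= b -> half_ratio a n <= half_ratio b n.
Proof.
  intros Hab; unfold half_ratio.
  induction n as [|n IH]; [simpl; lra|].
  rewrite !pochhammer_S. pose proof (pos_INR n).
  assert (forall x, 0 < x -> pochhammer x n * (x + INR n) / (pochhammer (x + 1 / 2) n * (x + 1 / 2 + INR n))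
     = half_ratio x n * ((x + INR n) / (x + 1 / 2 + INR n))) as E.
  { intros x Hx; unfold half_ratio.
    pose proof (pochhammer_pos (x + 1 / 2) n ltac:(lra)). field; lra. }
  rewrite !E by lra.
  pose proof (half_ratio_pos a n ltac:(lra)).
  apply Rmult_le_compat; [lra|apply Rlt_le, Rdiv_lt_0_compat; lra|exact IH|].
  apply Rle_div_l; [lra|].
  replace ((b + INR n) / (b + 1 / 2 + INR n) * (a + 1 / 2 + INR n))
    with ((b + INR n) * (a + 1 / 2 + INR n) / (b + 1 / 2 + INR n)) by (field; lra).
  apply Rle_div_r; [lra|nra].
Qed.

Lemma half_ratio_mul (a : R) (n : nat) : 0 < a ->
  half_ratio a n * half_ratio (a + 1 / 2) n = a / (a + INR n).
Proof.
  intros Ha; unfold half_ratio.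
  replace (a + 1 / 2 + 1 / 2) with (a + 1) by field.
  pose proof (pos_INR n).
  pose proof (pochhammer_shift a n) as E.
  pose proof (pochhammer_pos a n Ha).
  pose proof (pochhammer_pos (a + 1) n ltac:(lra)).
  pose proof (pochhammer_pos (a + 1 / 2) n ltac:(lra)).
  replace (pochhammer (a + 1) n) with (pochhammer a n * (a + INR n) / a)
    by (rewrite <- E; field; lra).
  field; lra.
Qed.

(** By monotonicity the square lies between the products of [half_ratio a n] with its neighbours at
    [a - 1 / 2] and [a + 1 / 2], and [half_ratio_mul] evaluates both products. *)
Lemma half_ratio_sqr (a : R) (n : nat) : 1 / 2 < a ->
  (a - 1 / 2) / (a - 1 / 2 + INR n) <= half_ratio a n ^ 2 <= a / (a + INR n).
Proof.
  intros Ha. pose proof (half_ratio_pos a n ltac:(lra)) as Hp. split.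
  - rewrite <- half_ratio_mul by lra.
    replace (a - 1 / 2 + 1 / 2) with a by ring.
    simpl; rewrite Rmult_1_r; apply Rmult_le_compat_r; [lra|].
    apply half_ratio_le; lra.
  - rewrite <- half_ratio_mul by lra.
    simpl; rewrite Rmult_1_r; apply Rmult_le_compat_l; [lra|].
    apply half_ratio_le; lra.
Qed.

Lemma is_lim_seq_half (c : R) :
  is_lim_seq (fun m => (c + INR m) / (c + INR m + INR m)) (1 / 2).
Proof.
  apply (is_lim_seq_ext_loc (fun m => 1 / 2 + c / 4 * / (INR m + c / 2))).
  (* For negative [c] the denominators may vanish at small indices; beyond the absolute value of [c]
     they are positive. *)
  - destruct (nfloor_ex (Rabs c) (Rabs_pos c)) as [N HN].
    exists (S N); intros n Hn. apply le_INR in Hn; rewrite S_INR in Hn.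
    pose proof (Rabs_pos c); pose proof (Rle_abs (- c)); rewrite Rabs_Ropp in *.
    field; lra.
  - replace (Finite (1 / 2)) with (Finite (1 / 2 + c / 4 * 0)) by (f_equal; ring).
    apply is_lim_seq_plus'; [apply is_lim_seq_const|].
    apply is_lim_seq_mult'; [apply is_lim_seq_const|apply is_lim_seq_inv_shift].
Qed.

Lemma half_ratio_lim (a : R) : 0 < a ->
  is_lim_seq (fun m => half_ratio (a + INR m) m) (sqrt (1 / 2)).
Proof.
  intros Ha.
  apply (is_lim_seq_ext (fun m => sqrt (half_ratio (a + INR m) m ^ 2))).
  { intros m; apply sqrt_pow2, Rlt_le, half_ratio_pos. pose proof (pos_INR m); lra. }
  apply (is_lim_seq_continuous sqrt).
  { apply continuity_pt_sqrt; lra. }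
  apply (is_lim_seq_le_le_loc (fun m => (a - 1 / 2 + INR m) / (a - 1 / 2 + INR m + INR m)) _
                              (fun m => (a + INR m) / (a + INR m + INR m)));
    [|apply is_lim_seq_half|apply is_lim_seq_half].
  (* [half_ratio_sqr] wants a base above 1/2, which [a + INR m] is sure to be only from [m = 1]
     on. *)
  exists 1%nat; intros m Hm. apply le_INR in Hm; simpl in Hm.
  pose proof (half_ratio_sqr (a + INR m) m ltac:(lra)) as H.
  replace (a - 1 / 2 + INR m) with (a + INR m - 1 / 2) by ring. exact H.
Qed.

(** * The Gessel-Stanton series *)

(* The Gessel-Stanton 5F4 with its parameters [a, b, n] set to [7/12 + x, 1/4, -5/6]; at [x = 0] a numerator
   and a denominator parameter 1/2 cancel. *)
Definition gs_term (x : R) (k : nat) : R :=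
  (1 / 4) ^ k
  * (pochhammer (7 / 6 + 2 * x) k * pochhammer (1 / 2) k ^ 2 * pochhammer (5 / 6) k
     / (pochhammer 1 k * pochhammer (4 / 3 + x) k ^ 2 * pochhammer (1 / 2 + 2 * x) k))
  * ((18 * INR k + 7 + 12 * x) / (7 + 12 * x)).

(** Quotient of the values of the sum at [x] and at [x + 1], as [Series_gs_rec] shows. *)
Definition gs_ratio (x : R) : R :=
  (13 / 6 + 2 * x) * (19 / 6 + 2 * x) * (1 / 2 + x) ^ 2
  / ((1 / 2 + 2 * x) * (3 / 2 + 2 * x) * (4 / 3 + x) ^ 2).

(** The WZ mate: a rational function times the summand. The factor [INR k] makes it vanish at
    [k = 0]. *)
Definition gs_cert (x : R) (k : nat) : R :=
  - 4 * INR k * (6 * INR k + 5 + 12 * x)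
  / ((1 / 2 + 2 * x + INR k) * (18 * INR k + 7 + 12 * x)) * gs_term x k.

Lemma pochhammer_succ (a : R) (k : nat) : 0 < a ->
  pochhammer (a + 1) k = pochhammer a k * (a + INR k) / a.
Proof. intros Ha; rewrite <- pochhammer_shift; field; lra. Qed.

Lemma gs_wz (x : R) (k : nat) : 0 <= x ->
  gs_term x k - gs_ratio x * gs_term (x + 1) k = gs_cert x (S k) - gs_cert x k.
Proof.
  intros Hx. unfold gs_cert, gs_ratio, gs_term.
  replace (7 / 6 + 2 * (x + 1)) with (7 / 6 + 2 * x + 1 + 1) by ring.
  replace (1 / 2 + 2 * (x + 1)) with (1 / 2 + 2 * x + 1 + 1) by ring.
  replace (4 / 3 + (x + 1)) with (4 / 3 + x + 1) by ring.
  (* Parameters containing [2 * x] move by 2 when [x] moves by 1, hence two shifts each. Once all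
     symbols have base [x] and length [k], they are abstracted, and a rational identity remains. *)
  rewrite (pochhammer_succ (7 / 6 + 2 * x + 1)), (pochhammer_succ (7 / 6 + 2 * x)),
    (pochhammer_succ (1 / 2 + 2 * x + 1)), (pochhammer_succ (1 / 2 + 2 * x)),
    (pochhammer_succ (4 / 3 + x)) by lra.
  rewrite !pochhammer_S, S_INR. simpl pow.
  pose proof (pochhammer_pos 1 k ltac:(lra)).
  pose proof (pochhammer_pos (4 / 3 + x) k ltac:(lra)).
  pose proof (pochhammer_pos (1 / 2 + 2 * x) k ltac:(lra)).
  pose proof (pos_INR k).
  generalize dependent (pochhammer 1 k); intros A HA.
  generalize dependent (pochhammer (4 / 3 + x) k); intros B HB.
  generalize dependent (pochhammer (1 / 2 + 2 * x) k); intros C HC.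
  generalize (pochhammer (7 / 6 + 2 * x) k); intros D.
  generalize (pochhammer (1 / 2) k); intros E.
  generalize (pochhammer (5 / 6) k); intros F.
  generalize ((1 / 4) ^ k); intros p.
  generalize dependent (INR k); intros y Hy.
  field. repeat split; lra.
Qed.

Lemma gs_term_0 (x : R) : 0 <= x -> gs_term x 0 = 1.
Proof. intros Hx; unfold gs_term; simpl; field; lra. Qed.

Lemma gs_term_pos (x : R) (k : nat) : 0 <= x -> 0 < gs_term x k.
Proof.
  intros Hx; unfold gs_term; pose proof (pos_INR k).
  repeat first [lra | apply Rmult_lt_0_compat | apply Rinv_0_lt_compat | apply pow_lt
               | apply pochhammer_pos].
Qed.

(** * Convergence of the series and summation of the WZ identity *)

Lemma quadratic_le_pow2 (k : nat) : (1 + 2 * INR k) * (1 + 3 * INR k) <= 12 * 2 ^ k.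
Proof.
  (* The quadratic 6 k^2 + 5 k + 1 grows by 12 k + 11, which is at most the quadratic itself only
     from [k = 2] on; there the doubling argument starts. *)
  destruct k as [|[|k]]; [simpl; lra|simpl; lra|].
  induction k as [|k IH]; [simpl; lra|].
  rewrite <- tech_pow_Rmult.
  rewrite !S_INR in *. pose proof (pos_INR k). nra.
Qed.

(** The geometric factor gives summability, and the factor 12 / (x + 1) sends everything beyond the
    leading term 1 to 0 as [x] grows. *)
Lemma gs_term_bound (x : R) (k : nat) : 0 <= x ->
  gs_term x (S k) <= 12 / (x + 1) * (1 / 2) ^ S k.
Proof.
  intros Hx.
  assert (Hd : forall a b, 0 <= a <= b -> 0 < b -> 0 <= a / b <= 1).
  { intros a b Hab Hb; split; [apply Rle_mult_inv_pos; lra|].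
    apply Rle_div_l; lra. }
  assert (HP : forall a b n, 0 < a <= b -> 0 <= pochhammer a n / pochhammer b n <= 1).
  { intros a b n Hab; apply Hd; [split|].
    - apply Rlt_le, pochhammer_pos; lra.
    - apply pochhammer_le; lra.
    - apply pochhammer_pos; lra. }
  pose proof (HP (1 / 2) 1 (S k) ltac:(lra)) as B1.
  pose proof (HP (1 / 2) (4 / 3 + x) (S k) ltac:(lra)) as B2.
  (* Taking out the first factors leaves (5/6) / (4/3 + x), the source of the decay in [x]. *)
  assert (B3 : 0 <= pochhammer (5 / 6) (S k) / pochhammer (4 / 3 + x) (S k) <= / (x + 1)).
  { pose proof (pochhammer_shift (5 / 6) k) as E1.
    pose proof (pochhammer_shift (4 / 3 + x) k) as E2.
    rewrite <- !pochhammer_S in E1, E2. rewrite <- E1, <- E2.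
    pose proof (HP (5 / 6 + 1) (4 / 3 + x + 1) k ltac:(lra)) as B.
    pose proof (pochhammer_pos (4 / 3 + x + 1) k ltac:(lra)).
    replace (5 / 6 * pochhammer (5 / 6 + 1) k / ((4 / 3 + x) * pochhammer (4 / 3 + x + 1) k))
      with (5 / 6 * / (4 / 3 + x) * (pochhammer (5 / 6 + 1) k / pochhammer (4 / 3 + x + 1) k))
      by (field; lra).
    assert (0 < / (4 / 3 + x) <= / (x + 1)).
    { split; [apply Rinv_0_lt_compat; lra|apply Rinv_le_contravar; lra]. }
    split; nra. }
  (* Raising 7/6 to 3/2 makes the two parameters differ by 1, so the ratio collapses to a linear
     function of the index. *)
  assert (B4 : 0 <= pochhammer (7 / 6 + 2 * x) (S k) / pochhammer (1 / 2 + 2 * x) (S k)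
               <= 1 + 2 * INR (S k)).
  { pose proof (pochhammer_pos (7 / 6 + 2 * x) (S k) ltac:(lra)).
    pose proof (pochhammer_pos (1 / 2 + 2 * x) (S k) ltac:(lra)).
    pose proof (pos_INR (S k)).
    split; [apply Rle_mult_inv_pos; lra|].
    apply Rle_div_l; [lra|].
    eapply Rle_trans; [apply (pochhammer_le _ (1 / 2 + 2 * x + 1)); lra|].
    rewrite pochhammer_succ by lra.
    apply Rle_div_l; [lra|].
    apply Rle_trans with (pochhammer (1 / 2 + 2 * x) (S k)
       * ((1 + 2 * INR (S k)) * (1 / 2 + 2 * x))); [|lra].
    apply Rmult_le_compat_l; nra. }
  assert (B5 : 0 <= (18 * INR (S k) + 7 + 12 * x) / (7 + 12 * x) <= 1 + 3 * INR (S k)).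
  { pose proof (pos_INR (S k)). split; [apply Rle_mult_inv_pos; lra|].
    apply Rle_div_l; [lra|nra]. }
  assert (B6 : (1 / 4) ^ S k * ((1 + 2 * INR (S k)) * (1 + 3 * INR (S k))) <= 12 * (1 / 2) ^ S k).
  { replace (1 / 4) with (1 / 2 * (1 / 2)) by field. rewrite Rpow_mult_distr.
    pose proof (quadratic_le_pow2 (S k)) as Hq.
    assert (Hh : 0 < (1 / 2) ^ S k) by (apply pow_lt; lra).
    assert (He : (1 / 2) ^ S k * 2 ^ S k = 1).
    { rewrite <- Rpow_mult_distr. replace (1 / 2 * 2) with 1 by field. apply pow1. }
    replace (12 * (1 / 2) ^ S k) with ((1 / 2) ^ S k * ((1 / 2) ^ S k * (12 * 2 ^ S k)))
      by (rewrite <- Rmult_assoc; transitivity (12 * (1/2)^ S k * ((1 / 2) ^ S k * 2 ^ S k)); [ring|rewrite He; ring]).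
    rewrite Rmult_assoc. apply Rmult_le_compat_l; [lra|]. apply Rmult_le_compat_l; lra. }
  unfold gs_term.
  pose proof (pochhammer_pos 1 (S k) ltac:(lra)).
  pose proof (pochhammer_pos (4 / 3 + x) (S k) ltac:(lra)).
  pose proof (pochhammer_pos (1 / 2 + 2 * x) (S k) ltac:(lra)).
  set (r1 := pochhammer (1 / 2) (S k) / pochhammer 1 (S k)) in *.
  set (r2 := pochhammer (1 / 2) (S k) / pochhammer (4 / 3 + x) (S k)) in *.
  set (r3 := pochhammer (5 / 6) (S k) / pochhammer (4 / 3 + x) (S k)) in *.
  set (r4 := pochhammer (7 / 6 + 2 * x) (S k) / pochhammer (1 / 2 + 2 * x) (S k)) in *.
  set (r5 := (18 * INR (S k) + 7 + 12 * x) / (7 + 12 * x)) in *.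
  assert (Hh : 0 < (1 / 4) ^ S k) by (apply pow_lt; lra).
  transitivity ((1 / 4) ^ S k * (r1 * r2 * r3 * (r4 * r5))).
  { apply Req_le. unfold r1, r2, r3, r4. field; lra. }
  assert (Hi : 0 < / (x + 1)) by (apply Rinv_0_lt_compat; lra).
  assert (r1 * r2 * r3 <= 1 * 1 * / (x + 1)).
  { apply Rmult_le_compat; [nra|lra| |lra]. apply Rmult_le_compat; lra. }
  assert (0 <= r1 * r2 * r3) by (apply Rmult_le_pos; [apply Rmult_le_pos|]; lra).
  assert (r4 * r5 <= (1 + 2 * INR (S k)) * (1 + 3 * INR (S k))) by (apply Rmult_le_compat; lra).
  assert (0 <= r4 * r5) by (apply Rmult_le_pos; lra).
  apply Rle_trans with ((1 / 4) ^ S k * (/ (x + 1) * ((1 + 2 * INR (S k)) * (1 + 3 * INR (S k))))).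
  { apply Rmult_le_compat_l; [lra|]. apply Rmult_le_compat; lra. }
  replace (12 / (x + 1) * (1 / 2) ^ S k) with (/ (x + 1) * (12 * (1 / 2) ^ S k)) by (unfold Rdiv; ring).
  rewrite <- Rmult_assoc, (Rmult_comm _ (/ (x + 1))), Rmult_assoc.
  apply Rmult_le_compat_l; lra.
Qed.

Lemma is_series_half_tail (c : R) : is_series (fun k => c * (1 / 2) ^ S k) c.
Proof.
  assert (H : is_series (fun k => (1 / 2) ^ k) (/ (1 - 1 / 2))).
  { apply is_series_geom; rewrite Rabs_pos_eq; lra. }
  apply (is_series_scal_l (c / 2)) in H.
  change (is_series (fun k => c / 2 * (1 / 2) ^ k) (c / 2 * / (1 - 1 / 2))) in H.
  replace (c / 2 * / (1 - 1 / 2)) with c in H by field.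
  eapply is_series_ext; [|exact H]. intros k; simpl; field.
Qed.

Lemma gs_tail (x : R) : 0 <= x ->
  ex_series (fun k => gs_term x (S k)) /\
  0 <= Series (fun k => gs_term x (S k)) <= 12 / (x + 1).
Proof.
  intros Hx.
  pose proof (is_series_half_tail (12 / (x + 1))) as Hg.
  assert (Hb : forall k, 0 <= gs_term x (S k) <= 12 / (x + 1) * (1 / 2) ^ S k).
  { intros k; split; [apply Rlt_le, gs_term_pos; exact Hx|apply gs_term_bound; exact Hx]. }
  assert (He : ex_series (fun k => gs_term x (S k))).
  { eapply (@ex_series_le R_AbsRing R_CompleteNormedModule); [|eexists; exact Hg].
    intros k. destruct (Hb k) as [H1 H2].
    change (Rabs (gs_term x (S k)) <= 12 / (x + 1) * (1 / 2) ^ S k).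
    rewrite Rabs_pos_eq; assumption. }
  split; [exact He|split].
  - rewrite <- (Rmult_0_l (Series (fun k => gs_term x (S k)))), <- Series_scal_l.
    apply Series_le; [intros k; destruct (Hb k); lra|exact He].
  - rewrite <- (is_series_unique _ _ Hg). apply Series_le; [exact Hb|eexists; exact Hg].
Qed.

Lemma ex_series_gs (x : R) : 0 <= x -> ex_series (gs_term x).
Proof. intros Hx; apply ex_series_incr_1, gs_tail, Hx. Qed.

Lemma Series_gs_bounds (x : R) : 0 <= x -> 1 <= Series (gs_term x) <= 1 + 12 / (x + 1).
Proof.
  intros Hx. rewrite Series_incr_1, gs_term_0 by (auto using ex_series_gs).
  pose proof (gs_tail x Hx) as [_ H]; lra.
Qed.

(** The rational factor stays between -4 and 0, and the terms of a convergent series tend to 0. *)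
Lemma gs_cert_lim (x : R) : 0 <= x -> is_lim_seq (gs_cert x) 0.
Proof.
  intros Hx.
  assert (Ht : is_lim_seq (fun k => - 4 * gs_term x k) 0).
  { replace 0 with (- 4 * 0) by ring.
    apply is_lim_seq_mult'; [apply is_lim_seq_const|].
    apply (ex_series_lim_0 (gs_term x)), ex_series_gs, Hx. }
  apply (is_lim_seq_le_le (fun k => - 4 * gs_term x k) _ (fun _ => 0)); [|exact Ht|apply is_lim_seq_const].
  intros k. unfold gs_cert. pose proof (gs_term_pos x k Hx). pose proof (pos_INR k).
  assert (0 <= 4 * INR k * (6 * INR k + 5 + 12 * x)
           / ((1 / 2 + 2 * x + INR k) * (18 * INR k + 7 + 12 * x)) <= 4).
  { assert (0 < (1 / 2 + 2 * x + INR k) * (18 * INR k + 7 + 12 * x)) by (apply Rmult_lt_0_compat; lra).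
    split; [apply Rle_mult_inv_pos; nra|]. apply Rle_div_l; nra. }
  replace (- 4 * INR k * (6 * INR k + 5 + 12 * x) / ((1 / 2 + 2 * x + INR k) * (18 * INR k + 7 + 12 * x)))
    with (- (4 * INR k * (6 * INR k + 5 + 12 * x) / ((1 / 2 + 2 * x + INR k) * (18 * INR k + 7 + 12 * x))))
    by (field; lra).
  split; nra.
Qed.

Lemma Series_gs_rec (x : R) : 0 <= x ->
  Series (gs_term x) = gs_ratio x * Series (gs_term (x + 1)).
Proof.
  intros Hx. apply Rminus_diag_uniq.
  rewrite <- Series_scal_l, <- Series_minus.
  2: apply ex_series_gs, Hx.
  2: apply (ex_series_scal_l (K := R_AbsRing) (V := R_NormedModule)), ex_series_gs; lra.
  apply is_series_unique.
  change (is_lim_seq (sum_n (fun k => gs_term x k - gs_ratio x * gs_term (x + 1) k)) 0).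
  (* [sum_n] includes the index [n], so the telescoped sum ends at [S n]; its lower end
     [gs_cert x 0] is 0. *)
  apply (is_lim_seq_ext (fun n => gs_cert x (S n))).
  - intros n; induction n as [|n IH].
    + rewrite sum_O, gs_wz by exact Hx.
      unfold gs_cert at 3; simpl INR; unfold Rdiv; ring.
    + rewrite sum_Sn, <- IH, gs_wz by exact Hx. unfold plus; simpl; ring.
  - apply (is_lim_seq_incr_1 (gs_cert x)), gs_cert_lim, Hx.
Qed.

(** * The sum as an infinite product, and its value *)

(** Product of [gs_ratio (INR j)] over j < m; halving the linear factors in [2 * x] gives the
    parameters in twelfths and quarters, and the powers of 2 cancel. *)
Definition gs_product (m : nat) : R :=
  pochhammer (13 / 12) m * pochhammer (19 / 12) m * pochhammer (1 / 2) m ^ 2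
  / (pochhammer (1 / 4) m * pochhammer (3 / 4) m * pochhammer (4 / 3) m ^ 2).

Lemma Series_gs_product (m : nat) :
  Series (gs_term 0) = gs_product m * Series (gs_term (INR m)).
Proof.
  induction m as [|m IH].
  - unfold gs_product; simpl; field.
  - rewrite IH, Series_gs_rec, <- S_INR, <- Rmult_assoc by apply pos_INR.
    f_equal. unfold gs_product, gs_ratio. rewrite !pochhammer_S.
    pose proof (pos_INR m).
    pose proof (pochhammer_pos (1 / 4) m ltac:(lra)).
    pose proof (pochhammer_pos (3 / 4) m ltac:(lra)).
    pose proof (pochhammer_pos (4 / 3) m ltac:(lra)).
    field; lra.
Qed.

(** The product equals the sum at 0 divided by the sum at [INR m], and that divisor is squeezed to
    1. *)
Lemma gs_product_lim : is_lim_seq gs_product (Series (gs_term 0)).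
Proof.
  assert (HS : is_lim_seq (fun m => Series (gs_term (INR m))) 1).
  { apply (is_lim_seq_le_le (fun _ => 1) _ (fun m => 1 + 12 * / (INR m + 1))).
    - intros m; apply Series_gs_bounds, pos_INR.
    - apply is_lim_seq_const.
    - replace (Finite 1) with (Finite (1 + 12 * 0)) by (f_equal; ring).
      apply is_lim_seq_plus'; [apply is_lim_seq_const|].
      apply is_lim_seq_mult'; [apply is_lim_seq_const|apply is_lim_seq_inv_shift]. }
  apply (is_lim_seq_ext (fun m => Series (gs_term 0) / Series (gs_term (INR m)))).
  - intros m. pose proof (Series_gs_bounds (INR m) (pos_INR m)).
    rewrite (Series_gs_product m). field; lra.
  - replace (Finite (Series (gs_term 0))) with (Finite (Series (gs_term 0) / 1))
      by (f_equal; field).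
    apply is_lim_seq_div'; [apply is_lim_seq_const|exact HS|lra].
Qed.

(* By Legendre duplication, [(13/6)_(2m) / (4/3)_m^2] reduces to the reflection products at 1/6 and 1/3. *)
Lemma gs_product_split (m : nat) :
  gs_product m
  = / cos_product (1 / 2) m * (cos_product (2 / 3) m / cos_product (1 / 3) m)
    * half_ratio (1 / 6 + INR m) m
    * (16 / 7 * ((1 / 12 + INR m) * (7 / 12 + INR m) / (1 / 3 + INR m) ^ 2)).
Proof.
  unfold cos_product, half_ratio, gs_product.
  replace (1 / 6 + INR m + 1 / 2) with (2 / 3 + INR m) by field.
  replace ((1 - 1 / 2) / 2) with (1 / 4) by field.
  replace ((1 + 1 / 2) / 2) with (3 / 4) by field.
  replace ((1 - 2 / 3) / 2) with (1 / 6) by field.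
  replace ((1 + 2 / 3) / 2) with (5 / 6) by field.
  replace ((1 - 1 / 3) / 2) with (1 / 3) by field.
  replace ((1 + 1 / 3) / 2) with (2 / 3) by field.
  (* Computing the symbols of length [m + m] both by splitting and by duplication expresses the two
     shifted symbols of [half_ratio] by unshifted ones. *)
  pose proof (pochhammer_split (1 / 6) m m) as E1.
  pose proof (pochhammer_split (2 / 3) m m) as E2.
  rewrite pochhammer_double in E1, E2.
  replace (1 / 6 / 2) with (1 / 12) in E1 by field.
  replace ((1 / 6 + 1) / 2) with (7 / 12) in E1 by field.
  replace (2 / 3 / 2) with (1 / 3) in E2 by field.
  replace ((2 / 3 + 1) / 2) with (5 / 6) in E2 by field.
  (* Lowering these parameters by 1 costs the rational end factor; its constant is (1/3)^2 / (1/12 *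
     7/12) = 16/7. *)
  replace (13 / 12) with (1 / 12 + 1) by field.
  replace (19 / 12) with (7 / 12 + 1) by field.
  replace (4 / 3) with (1 / 3 + 1) by field.
  rewrite !pochhammer_succ by lra.
  pose proof (pos_INR m).
  pose proof (pochhammer_pos (1 / 2) m ltac:(lra)).
  pose proof (pochhammer_pos (1 / 3) m ltac:(lra)).
  pose proof (pochhammer_pos (1 / 4) m ltac:(lra)).
  pose proof (pochhammer_pos (2 / 3) m ltac:(lra)).
  pose proof (pochhammer_pos (3 / 4) m ltac:(lra)).
  pose proof (pochhammer_pos (5 / 6) m ltac:(lra)).
  pose proof (pochhammer_pos (1 / 6) m ltac:(lra)).
  pose proof (pochhammer_pos (2 / 3 + INR m) m ltac:(lra)).
  assert (0 < 4 ^ m) by (apply pow_lt; lra).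
  replace (pochhammer (1 / 6 + INR m) m)
    with (4 ^ m * (pochhammer (1 / 12) m * pochhammer (7 / 12) m) / pochhammer (1 / 6) m)
    by (rewrite E1; field; lra).
  replace (pochhammer (2 / 3 + INR m) m)
    with (4 ^ m * (pochhammer (1 / 3) m * pochhammer (5 / 6) m) / pochhammer (2 / 3) m)
    by (rewrite E2; field; lra).
  field; repeat split; lra.
Qed.

Lemma Series_gs_0 : Series (gs_term 0) = 16 * sqrt 3 / 21.
Proof.
  pose proof (cos_product_lim (1 / 2) ltac:(lra)) as L1.
  pose proof (cos_product_lim (1 / 3) ltac:(lra)) as L2.
  pose proof (cos_product_lim (2 / 3) ltac:(lra)) as L3.
  pose proof (half_ratio_lim (1 / 6) ltac:(lra)) as L4.
  replace (1 / 2 * (PI / 2)) with (PI / 4) in L1 by field.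
  replace (1 / 3 * (PI / 2)) with (PI / 6) in L2 by field.
  replace (2 / 3 * (PI / 2)) with (PI / 3) in L3 by field.
  rewrite cos_PI4 in L1; rewrite cos_PI6 in L2; rewrite cos_PI3 in L3.
  assert (H2 : 0 < sqrt 2) by (apply sqrt_lt_R0; lra).
  assert (H3 : 0 < sqrt 3) by (apply sqrt_lt_R0; lra).
  assert (L5 : is_lim_seq (fun m => (1 / 12 + INR m) * (7 / 12 + INR m) / (1 / 3 + INR m) ^ 2) 1).
  (* Centred at y = m + 1/3, the numerator is (y - 1/4) (y + 1/4). *)
  { apply (is_lim_seq_ext (fun m => (1 - 1 / 4 * / (INR m + 1 / 3)) * (1 + 1 / 4 * / (INR m + 1 / 3)))).
    - intros m; pose proof (pos_INR m). field; lra.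
    - pose proof (is_lim_seq_inv_shift (1 / 3)) as L.
      replace (Finite 1) with (Finite ((1 - 1 / 4 * 0) * (1 + 1 / 4 * 0))) by (f_equal; ring).
      apply is_lim_seq_mult'; [apply is_lim_seq_minus'|apply is_lim_seq_plus'];
        try apply is_lim_seq_const; apply is_lim_seq_mult'; auto using is_lim_seq_const. }
  assert (L : is_lim_seq gs_product
    (/ (1 / sqrt 2) * (1 / 2 / (sqrt 3 / 2)) * sqrt (1 / 2) * (16 / 7 * 1))).
  { eapply is_lim_seq_ext; [intros m; symmetry; apply gs_product_split|].
    apply is_lim_seq_mult'; [apply is_lim_seq_mult'; [apply is_lim_seq_mult'|exact L4]|].
    - replace (Finite (/ (1 / sqrt 2))) with (Rbar_inv (1 / sqrt 2)) by reflexivity.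
      apply is_lim_seq_inv; [exact L1|].
      intros E; injection E; apply Rgt_not_eq, Rdiv_lt_0_compat; lra.
    - apply is_lim_seq_div'; [exact L3|exact L2|lra].
    - apply is_lim_seq_mult'; [apply is_lim_seq_const|exact L5]. }
  apply is_lim_seq_unique in L. pose proof (is_lim_seq_unique _ _ gs_product_lim) as L'.
  rewrite L' in L. injection L as ->.
  rewrite sqrt_div by lra. rewrite sqrt_1.
  pose proof (sqrt_sqrt 3 ltac:(lra)) as E3.
  apply (Rmult_eq_reg_r (sqrt 3)); [|lra].
  replace (16 * sqrt 3 / 21 * sqrt 3) with (16 * (sqrt 3 * sqrt 3) / 21) by field.
  rewrite E3. field; lra.
Qed.

Theorem mainTheorem6 :
  is_series
    (fun k : nat =>
       (1 / 4) ^ k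
       * ((pochhammer (1 / 2) k * pochhammer (5 / 6) k * pochhammer (7 / 6) k)
          / (pochhammer 1 k * pochhammer (4 / 3) k * pochhammer (4 / 3) k))
       * (18 * INR k + 7))
    (16 * sqrt 3 / 3).
Proof.
  (* [gs_term] is normalised to 1 at [k = 0], so its linear factor is (18 k + 7) / 7 at [x = 0]. *)
  replace (16 * sqrt 3 / 3) with (7 * Series (gs_term 0)) by (rewrite Series_gs_0; field).
  apply (is_series_ext (fun k => 7 * gs_term 0 k)).
  - intros k; unfold gs_term. rewrite !Rmult_0_r, !Rplus_0_r.
    pose proof (pochhammer_pos 1 k ltac:(lra)).
    pose proof (pochhammer_pos (1 / 2) k ltac:(lra)).
    pose proof (pochhammer_pos (4 / 3) k ltac:(lra)).
    (* The equation is typed in the carrier of a normed module; [field] needs it in [R]. *)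
    match goal with |- ?l = ?r => change (@eq R l r) end.
    simpl pow; field; lra.
  - apply (is_series_scal_l (K := R_AbsRing) (V := R_NormedModule)), Series_correct, ex_series_gs; lra.
Qed.
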